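(* Let $(\mathcal T,[1],\Delta)$ be a triangulated category and $\xi$ a proper class of triangles. Then $\xi$ is closed under rotations if and only if $\xi=\Delta$.
   Context: $(\mathcal T,[1],\Delta)$ denotes a triangulated category with suspension autoequivalence $[1]$ (quasi-inverse $[-1]$) and class $\Delta$ of all (distinguished) triangles. A triangle $X\xrightarrow{u}Y\xrightarrow{v}Z\xrightarrow{w}X[1]$ is splitting if $w=0$. A class $\xi\subseteq\Delta$ is a proper class of triangles if: (i) it contains all splitting triangles; (ii) it is closed under isomorphisms of triangles, finite coproducts and suspensions (if $X\xrightarrow{u}Y\xrightarrow{v}Z\xrightarrow{w}X[1]$ is in $\xi$ then so is $X[i]\xrightarrow{(-1)^iu[i]}Y[i]\xrightarrow{(-1)^iv[i]}Z[i]\xrightarrow{(-1)^iw[i]}X[i+1]$ for all $i\in\mathbb Z$); (iii) it is closed under base changes (if $X\to Y\to Z\xrightarrow{w}X[1]$ is in $\xi$ and $\alpha:Z'\to Z$ is any morphism, then the triangle $X\to Y'\to Z'\xrightarrow{w\alpha}X[1]$ is in $\xi$) and cobase changes (if moreover $\beta:X\to X'$ is any morphism, then the triangle $X'\to Y'\to Z\xrightarrow{\beta[1]w}X'[1]$ is in $\xi$); (iv) it is saturated: for any triangle $X\to Y\to Z\xrightarrow{w}X[1]$ and any morphism $\alpha:Z'\to Z$ embedded in a triangle $X'\to Z'\xrightarrow{\alpha}Z\to X'[1]$ in $\xi$, if the base change $X\to Y'\to Z'\xrightarrow{w\alpha}X[1]$ is in $\xi$, then $X\to Y\to Z\xrightarrow{w}X[1]$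 is in $\xi$. $\xi$ is closed under rotations if, whenever $X\xrightarrow{u}Y\xrightarrow{v}Z\xrightarrow{w}X[1]$ is in $\xi$, the triangles $Y\xrightarrow{v}Z\xrightarrow{w}X[1]\xrightarrow{-u[1]}Y[1]$ and $Z[-1]\xrightarrow{-w[-1]}X\xrightarrow{u}Y\xrightarrow{v}Z$ are in $\xi$. *)

(* Defs.v *)
From HB Require Import structures.
From mathcomp Require Import all_boot all_algebra.
From mathcomp Require Import classical_sets.

Set Implicit Arguments.
Unset Strict Implicit.
Unset Printing Implicit Defensive.

Import GRing.Theory.
Local Open Scope classical_set_scope.
Local Open Scope ring_scope.

Declare Scope cat_scope.
Delimit Scope cat_scope with cat.
Local Open Scope cat_scope.

Record preaddCat := PreaddCat {
  obj :> Type;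
  hom : obj -> obj -> zmodType;
  idm : forall X, hom X X;
  compm : forall X Y Z, hom Y Z -> hom X Y -> hom X Z;
  compmA : forall X Y Z W (h : hom Z W) (g : hom Y Z) (f : hom X Y),
    compm h (compm g f) = compm (compm h g) f;
  comp1m : forall X Y (f : hom X Y), compm (idm Y) f = f;
  compm1 : forall X Y (f : hom X Y), compm f (idm X) = f;
  compmDl : forall X Y Z (g g' : hom Y Z) (f : hom X Y),
    compm (g + g') f = compm g f + compm g' f;
  compmDr : forall X Y Z (g : hom Y Z) (f f' : hom X Y),
    compm g (f + f') = compm g f + compm g f' }.

Arguments idm {_} X.

Notation "X ~> Y" := (hom X Y) (at level 90, Y at next level) : cat_scope.
Notation "g ∘ f" := (compm g f) (at level 40, left associativity) : cat_scope.

Definition isomorphism (C : preaddCat) (X Y : C) (f : X ~> Y) : Prop :=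
  exists g : Y ~> X, g ∘ f = idm X /\ f ∘ g = idm Y.

Definition is_coproduct (C : preaddCat) (n : nat) (X : 'I_n -> C) (S : C)
    (inj : forall k, X k ~> S) : Prop :=
  forall (A : C) (f : forall k, X k ~> A),
    exists! h : S ~> A, forall k, h ∘ inj k = f k.

Record addCat := AddCat {
  addCat_base :> preaddCat;
  zob : addCat_base;
  zob_initial : forall (X : addCat_base) (f : zob ~> X), f = 0;
  zob_terminal : forall (X : addCat_base) (f : X ~> zob), f = 0;
  has_coproducts : forall (n : nat) (X : 'I_n -> addCat_base),
    exists (S : addCat_base) (inj : forall k, X k ~> S), is_coproduct inj }.

Arguments zob {_}.

Record endo (C : preaddCat) := Endo {
  fobj :> C -> C;
  fmap : forall X Y : C, (X ~> Y) -> (fobj X ~> fobj Y);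
  fmap1 : forall X : C, fmap (idm X) = idm (fobj X);
  fmapM : forall (X Y Z : C) (g : Y ~> Z) (f : X ~> Y),
    fmap (g ∘ f) = fmap g ∘ fmap f;
  fmapD : forall (X Y : C) (f g : X ~> Y), fmap (f + g) = fmap f + fmap g }.

Arguments fmap {C} e {X Y} _.

Definition endo_id (C : preaddCat) : endo C :=
  @Endo C (fun X => X) (fun _ _ f => f) (fun _ => erefl)
    (fun _ _ _ _ _ => erefl) (fun _ _ _ _ => erefl).

Definition endo_comp (C : preaddCat) (F G : endo C) : endo C.
Proof.
refine (@Endo C (fun X => F (G X)) (fun _ _ f => fmap F (fmap G f)) _ _ _).
- by move=> X; rewrite !fmap1.
- by move=> X Y Z g f; rewrite !fmapM.
- by move=> X Y f g; rewrite !fmapD.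
Defined.

(* [susp] is [1] and [desusp] is the quasi-inverse [-1].  The comparison
   isomorphisms [su_map : X[1][-1] -> X] and [us_map : X[-1][1] -> X] form an
   adjoint equivalence; every equivalence can be so normalised, and without
   [su_us] the identifications implicit in writing [Z[-1] -> X -> Y -> Z] for a
   rotated triangle would only be correct up to an automorphism of the identity
   functor (for instance a sign). The other triangle identity follows. *)
Record suspCat := SuspCat {
  suspCat_base :> addCat;
  susp : endo suspCat_base;
  desusp : endo suspCat_base;
  su_map : forall X : suspCat_base, desusp (susp X) ~> X;
  su_inv : forall X : suspCat_base, X ~> desusp (susp X);
  su_mapK : forall X, su_inv X ∘ su_map X = idm _;
  su_invK : forall X, su_map X ∘ su_inv X = idm _;
  su_nat : forall (X Y : suspCat_base) (f : X ~> Y),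
    f ∘ su_map X = su_map Y ∘ fmap desusp (fmap susp f);
  us_map : forall X : suspCat_base, susp (desusp X) ~> X;
  us_inv : forall X : suspCat_base, X ~> susp (desusp X);
  us_mapK : forall X, us_inv X ∘ us_map X = idm _;
  us_invK : forall X, us_map X ∘ us_inv X = idm _;
  us_nat : forall (X Y : suspCat_base) (f : X ~> Y),
    f ∘ us_map X = us_map Y ∘ fmap susp (fmap desusp f);
  su_us : forall X : suspCat_base, fmap susp (su_map X) = us_map (susp X) }.

Arguments susp {_}.
Arguments desusp {_}.
Arguments su_map {_} X.
Arguments su_inv {_} X.
Arguments us_map {_} X.
Arguments us_inv {_} X.

Section IteratedSuspension.
Variable T : suspCat.

Definition suspn (n : nat) : endo T := iter n (endo_comp susp) (endo_id T).
Definition desuspn (n : nat) : endo T :=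
  iter n (endo_comp desusp) (endo_id T).

Definition suspz (i : int) : endo T :=
  match i with Posz n => suspn n | Negz n => desuspn n.+1 end.

(* The canonical isomorphism [X[1][i] -> X[i][1]], both sides of which are
   written [X[i+1]] when [1] is treated as an automorphism. *)
Fixpoint swapn (n : nat) (X : T) : suspn n (susp X) ~> susp (suspn n X) :=
  match n with
  | 0 => idm (susp X)
  | m.+1 => fmap susp (swapn m X)
  end.

Fixpoint deswapn (n : nat) (X : T) :
    desuspn n (susp X) ~> susp (desuspn n X) :=
  match n with
  | 0 => idm (susp X)
  | m.+1 => us_inv (desuspn m X) ∘ su_map (desuspn m X)
              ∘ fmap desusp (deswapn m X)
  end.

Definition swapz (i : int) (X : T) : suspz i (susp X) ~> susp (suspz i X) :=
  match i with Posz n => swapn n X | Negz n => deswapn n.+1 X end.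

End IteratedSuspension.

(* Diagrams [X -> Y -> Z -> X[1]], not assumed distinguished. *)
Record triangle (T : suspCat) := Triangle {
  tX : T; tY : T; tZ : T;
  tu : tX ~> tY;
  tv : tY ~> tZ;
  tw : tZ ~> susp tX }.

Section Triangles.
Variable T : suspCat.
Implicit Types A B : triangle T.

Definition tri_morph A B (f : tX A ~> tX B) (g : tY A ~> tY B)
    (h : tZ A ~> tZ B) : Prop :=
  [/\ g ∘ tu A = tu B ∘ f, h ∘ tv A = tv B ∘ g &
      fmap susp f ∘ tw A = tw B ∘ h].

Definition tri_iso A B : Prop :=
  exists f g h,
    [/\ @tri_morph A B f g h, isomorphism f, isomorphism g & isomorphism h].

Definition is_tri_coproduct (n : nat) (A : 'I_n -> triangle T) B : Prop :=
  exists (f : forall k, tX (A k) ~> tX B) (g : forall k, tY (A k) ~> tY B)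
         (h : forall k, tZ (A k) ~> tZ B),
    [/\ forall k, tri_morph (f k) (g k) (h k),
        is_coproduct f, is_coproduct g & is_coproduct h].

Definition tri_rot A : triangle T :=
  Triangle (tv A) (tw A) (- fmap susp (tu A)).

(* [Z[-1] -> X -> Y -> Z], with [X[1][-1]] identified with [X] and [Z] with
   [Z[-1][1]]. *)
Definition tri_unrot A : triangle T :=
  Triangle (- (su_map (tX A) ∘ fmap desusp (tw A))) (tu A)
           (us_inv (tZ A) ∘ tv A).

(* [X[i] -> Y[i] -> Z[i] -> X[i+1]], every morphism scaled by (-1)^i. *)
Definition tri_susp (i : int) A : triangle T :=
  Triangle (fmap (suspz T i) (tu A) *~ (-1) ^ i)
           (fmap (suspz T i) (tv A) *~ (-1) ^ i)
           ((swapz i (tX A) ∘ fmap (suspz T i) (tw A)) *~ (-1) ^ i).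

End Triangles.

Record triCat := TriCat {
  triCat_base :> suspCat;
  Delta : set (triangle triCat_base);
  Delta_iso : forall A B, tri_iso A B -> Delta A -> Delta B;
  Delta_id : forall X : triCat_base,
    Delta (@Triangle triCat_base X X zob (idm X) 0 0);
  Delta_cone : forall (X Y : triCat_base) (u : X ~> Y),
    exists (Z : triCat_base) (v : Y ~> Z) (w : Z ~> susp X),
      Delta (Triangle u v w);
  Delta_rot : forall A, Delta A <-> Delta (tri_rot A);
  Delta_fill : forall A B (f : tX A ~> tX B) (g : tY A ~> tY B),
    Delta A -> Delta B -> g ∘ tu A = tu B ∘ f -> exists h, tri_morph f g h;
  Delta_oct : forall (X Y Z X' Y' Z' : triCat_base) (u : X ~> Y) (v : Y ~> Z)
      (j : Y ~> Z') (k : Z' ~> susp X) (l : Z ~> X') (i : X' ~> susp Y)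
      (m : Z ~> Y') (n : Y' ~> susp X),
    Delta (Triangle u j k) -> Delta (Triangle v l i) ->
    Delta (Triangle (v ∘ u) m n) ->
    exists (f : Z' ~> Y') (g : Y' ~> X'),
      [/\ Delta (Triangle f g (fmap susp j ∘ i)),
          f ∘ j = m ∘ v, n ∘ f = k, g ∘ m = l & i ∘ g = fmap susp u ∘ n] }.

Arguments Delta : clear implicits.

Section ProperClass.
Variable T : triCat.
Implicit Types xi : set (triangle T).

Definition splitting (A : triangle T) : Prop := Delta T A /\ tw A = 0.

(* A base change is determined only up to isomorphism, by its third morphism;
   the conditions below range over all triangles having that morphism. *)
Definition closed_base_change xi : Prop :=
  forall (X Y Z Y' Z' : T) (u : X ~> Y) (v : Y ~> Z) (w : Z ~> susp X)
      (alpha : Z' ~> Z) (u' : X ~> Y') (v' : Y' ~> Z'),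
    xi (Triangle u v w) -> Delta T (Triangle u' v' (w ∘ alpha)) ->
    xi (Triangle u' v' (w ∘ alpha)).

Definition closed_cobase_change xi : Prop :=
  forall (X Y Z X' Y' : T) (u : X ~> Y) (v : Y ~> Z) (w : Z ~> susp X)
      (beta : X ~> X') (u' : X' ~> Y') (v' : Y' ~> Z),
    xi (Triangle u v w) -> Delta T (Triangle u' v' (fmap susp beta ∘ w)) ->
    xi (Triangle u' v' (fmap susp beta ∘ w)).

Definition saturated xi : Prop :=
  forall (X Y Z X' Y' Z' : T) (u : X ~> Y) (v : Y ~> Z) (w : Z ~> susp X)
      (a : X' ~> Z') (alpha : Z' ~> Z) (b : Z ~> susp X')
      (u' : X ~> Y') (v' : Y' ~> Z'),
    Delta T (Triangle u v w) -> xi (Triangle a alpha b) ->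
    xi (Triangle u' v' (w ∘ alpha)) -> xi (Triangle u v w).

Record proper_class xi : Prop := ProperClass {
  proper_class_sub : xi `<=` Delta T;
  proper_class_splitting : forall A, splitting A -> xi A;
  proper_class_iso : forall A B, tri_iso A B -> xi A -> xi B;
  proper_class_coproduct : forall (n : nat) (A : 'I_n -> triangle T) B,
    (forall k, xi (A k)) -> is_tri_coproduct A B -> xi B;
  proper_class_susp : forall (i : int) A, xi A -> xi (tri_susp i A);
  proper_class_base_change : closed_base_change xi;
  proper_class_cobase_change : closed_cobase_change xi;
  proper_class_saturated : saturated xi }.

Definition closed_under_rotations xi : Prop :=
  forall A, xi A -> xi (tri_rot A) /\ xi (tri_unrot A).

End ProperClass.

(* Main.v *)
(* If [xi] is closed under rotations, it contains the rotation
   [X -> 0 -> X[1] --(-1)--> X[1]] of the splitting triangle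
   [X --1--> X -> 0 -> X[1]], and every triangle [X -> Y -> Z --w--> X[1]] is the
   base change of that rotation along [-w]. *)
Require Import Defs.
From mathcomp Require Import all_boot all_algebra classical_sets.

Set Implicit Arguments.
Unset Strict Implicit.
Unset Printing Implicit Defensive.

Import GRing.Theory.
Local Open Scope ring_scope.
Local Open Scope cat_scope.

Section Additive.
Variable C : preaddCat.

Lemma comp0m (X Y Z : C) (f : X ~> Y) : (0 : Y ~> Z) ∘ f = 0.
Proof. by apply: (addrI (0 ∘ f)); rewrite -compmDl !addr0. Qed.

Lemma compm0 (X Y Z : C) (g : Y ~> Z) : g ∘ (0 : X ~> Y) = 0.
Proof. by apply: (addrI (g ∘ 0)); rewrite -compmDr !addr0. Qed.

Lemma compNm (X Y Z : C) (g : Y ~> Z) (f : X ~> Y) : (- g) ∘ f = - (g ∘ f).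
Proof. by apply: (addrI (g ∘ f)); rewrite -compmDl !subrr comp0m. Qed.

Lemma compmN (X Y Z : C) (g : Y ~> Z) (f : X ~> Y) : g ∘ (- f) = - (g ∘ f).
Proof. by apply: (addrI (g ∘ f)); rewrite -compmDr !subrr compm0. Qed.

Lemma fmap0 (F : endo C) (X Y : C) : fmap F (0 : X ~> Y) = 0.
Proof. by apply: (addrI (fmap F 0)); rewrite -fmapD !addr0. Qed.

Lemma fmapN (F : endo C) (X Y : C) (f : X ~> Y) : fmap F (- f) = - fmap F f.
Proof. by apply: (addrI (fmap F f)); rewrite -fmapD !subrr fmap0. Qed.

Lemma isomorphism_idm (X : C) : isomorphism (idm X).
Proof. by exists (idm X); rewrite comp1m. Qed.

End Additive.

(** Rotating back and then forward replaces only the third object, [Z] becoming [Z[-1][1]]; hence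
    the comparison is the identity on the first two objects and [us_inv Z] on the third. *)
Lemma tri_rot_unrot_iso (T : suspCat) (A : triangle T) :
  tri_iso A (tri_rot (tri_unrot A)).
Proof.
case: A => X Y Z u v w; rewrite /tri_rot /tri_unrot /=.
exists (idm X), (idm Y), (us_inv Z); split; try exact: isomorphism_idm.
- split; rewrite /= ?comp1m ?compm1 //.
  (* Only the square on [w] remains. The two signs cancel, and [su_us] turns the suspended
     [su_map X] into [us_map (susp X)], past which [w] moves by naturality. *)
  rewrite fmapN opprK fmapM su_us -us_nat fmap1 comp1m.
  by rewrite -compmA us_invK compm1.
- by exists (us_map Z); rewrite us_mapK us_invK.
Qed.

(** The rotation axiom is an equivalence, so it is enough that the rotation of [tri_unrot A] is
    distinguished, and that triangle is isomorphic to [A]. *)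
Lemma Delta_unrot (T : triCat) (A : triangle T) :
  Delta T A -> Delta T (tri_unrot A).
Proof. by move=> DA; apply/Delta_rot/Delta_iso/DA/tri_rot_unrot_iso. Qed.

Theorem proposition2p10 (T : triCat) (xi : set (triangle T))
    (xi_proper : proper_class xi) :
  closed_under_rotations xi <-> xi = Delta T.
Proof.
split=> [xi_rot | ->]; last first.
  by move=> A DA; split; [exact: (Delta_rot A).1 | exact: Delta_unrot].
apply/seteqP; split; first exact: proper_class_sub xi_proper.
case=> X Y Z u v w DA.
have xi_split : xi (@Triangle T X X zob (idm X) 0 0).
  by apply: (proper_class_splitting xi_proper); split; first exact: Delta_id.
have [xi_rot_split _] := xi_rot _ xi_split.
have wE : w = - fmap susp (idm X) ∘ - w.
  by rewrite compmN compNm opprK fmap1 comp1m.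
(* Base change closure covers every distinguished triangle with the prescribed third morphism, so
   once [w] is factored, [u] and [v] need no comparison with a chosen base change. *)
rewrite wE in DA *.
exact: proper_class_base_change xi_rot_split DA.
Qed.
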